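(* Let $G$ be a connected simple graph on $n\geq 4$ vertices and let $k\geq 1$ be an integer. If $d(x)+d(y)\geq n+k$ for every edge $xy\in E(G)$, then the line graph $L(G)$ is $k$-hamiltonian.
   Context: Graphs are finite. $d(v)$ denotes the degree of the vertex $v$ in $G$. The line graph $L(G)$ has vertex set $E(G)$, two of its vertices being adjacent when the corresponding edges of $G$ share an end. A graph is hamiltonian if it has a cycle through all its vertices. A graph $H$ is $k$-hamiltonian if $H-X$ is hamiltonian for every $X\subseteq V(H)$ with $|X|\leq k$. *)

(* Defs.v *)
From mathcomp Require Import all_boot.

Set Implicit Arguments.
Unset Strict Implicit.
Unset Printing Implicit Defensive.

Record sgraph := SGraph {
  vertex :> finType;
  adj : rel vertex;
  adj_sym : symmetric adj;
  adj_irr : irreflexive adj }.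

Definition deg (G : sgraph) (v : G) : nat := #|[set w | adj v w]|.

(* Nonemptiness is not required. *)
Definition connected (G : sgraph) : Prop :=
  forall x y : G, connect (@adj G) x y.

Definition edge_set (G : sgraph) : {set {set G}} :=
  [set A : {set G} | [exists x, exists y, adj x y && (A == [set x; y])]].

Section LineGraph.
Variable G : sgraph.

Definition line_vertex : finType := {A : {set G} | A \in edge_set G}.

Definition line_adj : rel line_vertex :=
  [rel A B | (A != B) && (val A :&: val B != set0)].

Lemma line_adj_sym : symmetric line_adj.
Proof. by move=> A B; rewrite /line_adj /= eq_sym setIC. Qed.

Lemma line_adj_irr : irreflexive line_adj.
Proof. by move=> A; rewrite /line_adj /= eqxx. Qed.

Definition line_graph : sgraph := SGraph line_adj_sym line_adj_irr.
End LineGraph.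

Section VertexDeletion.
Variables (H : sgraph) (X : {set H}).

Definition del_vertex : finType := {x : H | x \notin X}.

Definition del_adj : rel del_vertex := [rel x y | adj (val x) (val y)].

Lemma del_adj_sym : symmetric del_adj.
Proof. by move=> x y; rewrite /del_adj /= adj_sym. Qed.

Lemma del_adj_irr : irreflexive del_adj.
Proof. by move=> x; rewrite /del_adj /= adj_irr. Qed.

Definition del_vertices : sgraph := SGraph del_adj_sym del_adj_irr.
End VertexDeletion.

(* [ucycle] accepts sequences of size 0 and 2, which are not cycles of a
   simple graph, hence the bound on the size. *)
Definition hamiltonian (H : sgraph) : Prop :=
  exists c : seq H, [/\ 2 < size c, ucycle (@adj H) c & forall x : H, x \in c].

Definition k_hamiltonian (k : nat) (H : sgraph) : Prop :=
  forall X : {set H}, #|X| <= k -> hamiltonian (del_vertices X).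

(* Main.v *)
Require Import Defs.
From mathcomp Require Import all_boot zify.

Set Implicit Arguments.
Unset Strict Implicit.
Unset Printing Implicit Defensive.

(** Let H be the graph left after deleting the edges of X from G. An edge xy of
    H is not in X, so each deleted edge lowers at most one of d(x) and d(y);
    hence d(x) + d(y) >= n still holds in H for every edge xy of H. It remains
    to prove the theorem of Brualdi and Shanny that a graph on n >= 4 vertices
    which has an edge and satisfies this condition has a hamiltonian line graph
    ([degree_sum_edges_hamiltonian]).

    Call a vertex heavy when its degree is at least n/2. Every edge has a heavy
    end, so a cycle through all heavy vertices meets every edge, and such a
    dominating cycle v_0 v_1 ... of H yields a Hamilton cycle of the line graph
    ([dominating_cycle_spans]): visit the edges assigned to v_0, then v_0 v_1,
    then the edges assigned to v_1, then v_1 v_2, and so on.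

    The cycle through the heavy vertices comes from Ore's argument
    ([cycle_through]). List the heavy vertices in any cyclic order; consecutive
    vertices that are not adjacent form a gap. The two ends of a gap have degree
    sum at least n. Either they have a common neighbour outside the list, which
    can be inserted, or the classical crossing argument reverses a segment of
    the list; both lower the number of gaps and create none elsewhere.

    The outcome may be a degenerate cycle, made of the two ends u and v of an
    edge that meets all edges. If u and v have a common neighbour, they lie in a
    dominating triangle. Otherwise the degree condition forces all edges to
    share one of u and v, so that the line graph is complete, and it has at
    least three vertices because n >= 4. *)

(** * Gaps of a sequence with respect to a relation *)

Definition nbrs (T : finType) (e : rel T) (x : T) : {set T} := [set y | e x y].

Definition gaps (T : Type) (e : rel T) (x : T) (p : seq T) : nat :=
  count id (pairmap (fun a b => ~~ e a b) x p).

(** The closing pair is counted by repeating the first entry at the end, as in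
    the definition of [cycle]. *)
Definition cyclic_gaps (T : Type) (e : rel T) (c : seq T) : nat :=
  if c is x :: p then gaps e x (rcons p x) else 0.

Lemma gaps_cat (T : Type) (e : rel T) x p q :
  gaps e x (p ++ q) = gaps e x p + gaps e (last x p) q.
Proof. by rewrite /gaps pairmap_cat count_cat. Qed.

Lemma gaps_cons (T : Type) (e : rel T) x y p :
  gaps e x (y :: p) = ~~ e x y + gaps e y p.
Proof. by []. Qed.

Lemma gaps_rev (T : Type) (e : rel T) x p :
  symmetric e -> gaps e (last x p) (rev (belast x p)) = gaps e x p.
Proof.
move=> e_sym; elim: p x => //= y p IHp x.
rewrite rev_cons -cats1 gaps_cat IHp gaps_cons e_sym addnC addn0; congr (_ + _).
by case: p {IHp} => //= z p; rewrite rev_cons last_rcons e_sym.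
Qed.

Lemma no_gap_cycle (T : Type) (e : rel T) c : cyclic_gaps e c = 0 -> cycle e c.
Proof.
case: c => //= x p; move: (rcons p x) => {}p.
by elim: p x => //= y p IHp x; rewrite gaps_cons; case: (e x y) => //= /IHp.
Qed.

Lemma path_gap (T : Type) (e : rel T) x p :
  ~~ path e x p -> exists p1 y p2, p = p1 ++ y :: p2 /\ ~~ e (last x p1) y.
Proof.
elim: p x => //= y p IHp x; rewrite negb_and; case exy: (e x y) => /=; last first.
  by move=> _; exists [::], y, p; rewrite exy.
by case/IHp=> p1 [z] [p2] [-> not_e]; exists (y :: p1), z, p2.
Qed.

(** Ore's pigeonhole: [a] selects entries of [p] and [b] selects predecessors of
    entries of [p]. There are only [size p] consecutive pairs, so if the two
    selections are larger than that in total, some pair is selected twice. *)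
Lemma ore_crossing (T : Type) (a b : pred T) x p :
  size p < count a p + count b (belast x p) ->
  exists p1 y p2, [/\ p = p1 ++ y :: p2, a y & b (last x p1)].
Proof.
elim: p x => //= y p IHp x; case: (boolP (a y && b x)) => [/andP[ay bx] _|].
  by exists [::], y, p.
move=> not_ab lt_p; have /IHp : size p < count a p + count b (belast y p).
  by move: not_ab lt_p; case: (a y) (b x) => [] [] //=; lia.
by case=> p1 [z] [p2] [-> az bz]; exists (y :: p1), z, p2.
Qed.

(** A gap can be rotated to the closing position, where it disappears when the
    cyclic sequence is read as a path. *)
Lemma rotate_gap (T : eqType) (e : rel T) c :
  ~~ cycle e c -> exists i x p,
    [/\ rot i c = x :: p, ~~ e (last x p) x
      & cyclic_gaps e c = (gaps e x p).+1].
Proof.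
case: c => //= x p not_path; have [p1 [y [p2 []]]] := path_gap not_path.
case/lastP: p2 => [|p2 z].
  rewrite cats1 => /rcons_inj[-> <-] not_e; exists 0, x, p1; rewrite rot0.
  by split=> //; rewrite -cats1 gaps_cat gaps_cons not_e /= /gaps /=; lia.
rewrite -rcons_cons -rcons_cat => /rcons_inj[-> _] not_e.
exists (size p1).+1, y, (p2 ++ x :: p1); split.
- by rewrite -cat_cons -[(size p1).+1]/(size (x :: p1)) rot_size_cat.
- by rewrite last_cat /=.
rewrite -cats1 -catA gaps_cat cat_cons gaps_cons not_e !gaps_cat !gaps_cons.
by rewrite /= /gaps /=; lia.
Qed.

Lemma card_nbrs_in (T : finType) (e : rel T) x c :
  uniq c -> #|nbrs e x :&: [set z in c]| = count (e x) c.
Proof.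
move=> Uc; rewrite -size_filter -(card_uniqP (filter_uniq _ Uc)).
by apply: eq_card => z; rewrite !inE mem_filter.
Qed.

(** * A cycle through all vertices of large degree *)

Section Closing.

Variables (T : finType) (e : rel T) (B : {set T}).
Hypothesis e_sym : symmetric e.
Hypothesis e_irr : irreflexive e.
Hypothesis ore_B : {in B &, forall x y, #|T| <= #|nbrs e x| + #|nbrs e y|}.

(** The pairs allowed to be consecutive while gaps are being closed: every gap
    has both ends in [B], so that [ore_B] applies to it. *)
Let e' : rel T := fun x y => e x y || (x \in B) && (y \in B).

(** Reading a cyclic sequence from one end of a gap to the other, its remaining
    gaps are those of the path [x :: p]. The ends can be joined without making
    new gaps, by a common neighbour outside the path if there is one. Otherwise
    their neighbourhoods outside the path are disjoint, so they have at least
    [size (x :: p)] neighbours on the path in total and [ore_crossing] gives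
    consecutive vertices z and y of the path with [last x p] adjacent to z and
    [x] to y: jump from z to the last vertex and run back to y. *)
Lemma close_gap x p :
  uniq (x :: p) -> path e' x p -> x \in B -> last x p \in B ->
  exists c, [/\ uniq c, {subset x :: p <= c}, cycle e' c
              & cyclic_gaps e c <= gaps e x p].
Proof.
set v := last x p => Uc e'p Bx Bv.
pose S := [set z in x :: p].
have card_S : #|S| = (size p).+1.
  by rewrite -[RHS]/(size (x :: p)) -(card_uniqP Uc) cardsE.
case: (set_0Vmem ((nbrs e x :&: nbrs e v) :\: S)) => [no_w|[w]].
- have cnt : size p < count (e x) p + count (e v) (belast x p).
    have := card_nbrs_in e x Uc; have := card_nbrs_in e v Uc.
    rewrite /= e_irr add0n -/S.
    have -> : e v x + count (e v) p = count (e v) (belast x p).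
      rewrite -[LHS]/(count (e v) (x :: p)) lastI -/v -cats1 count_cat /= e_irr.
      by rewrite !addn0.
    move=> <- <-; have := ore_B Bx Bv.
    have := subset_leq_card (subsetDr (nbrs e x :|: nbrs e v) S).
    rewrite setDUl cardsU -setDIl no_w cards0 subn0 -(cardsC S) card_S.
    rewrite -(cardsID S (nbrs e x)) -(cardsID S (nbrs e v)).
    by move: (size p) => m; lia.
  have [p1 [y [p2 [def_p exy ev]]]] := ore_crossing cnt.
  have vE : last y p2 = v by rewrite /v def_p last_cat.
  have perm_c : perm_eq (x :: p1 ++ rev (y :: p2)) (x :: p).
    by rewrite def_p perm_cons perm_cat2l perm_rev.
  exists (x :: p1 ++ rev (y :: p2)); split.
  + by rewrite (perm_uniq perm_c).
  + by move=> z; rewrite (perm_mem perm_c).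
  + move: e'p; rewrite def_p cat_path /= => /and3P[e'p1 _ e'p2].
    rewrite rcons_cat cat_path e'p1 /= lastI rev_rcons /= vE.
    rewrite {1}/e' e_sym ev /= rcons_path -vE rev_path.
    rewrite (eq_path (e' := e')) ?e'p2 /=; last first.
      by move=> a b; rewrite /e' e_sym andbC.
    case: (p2) => [|z q] /=; first by rewrite /e' e_sym exy.
    by rewrite rev_cons last_rcons /e' e_sym exy.
  rewrite def_p /= rcons_cat !gaps_cat lastI rev_rcons /= vE !gaps_cons.
  rewrite e_sym ev /= -cats1 gaps_cat -vE gaps_rev // gaps_cons.
  suff -> : e (last (last y p2) (rev (belast y p2))) x.
    rewrite -lastI gaps_cons leq_add2l add0n /= add0n [gaps _ _ [::]]/gaps.
    by rewrite addn0 leq_addl.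
  case: (p2) => [|z q] /=; first by rewrite e_sym exy.
  by rewrite rev_cons last_rcons e_sym exy.
rewrite !inE negb_or => /andP[/andP[w_x w_p] /andP[exw evw]].
exists (x :: rcons p w); split.
- by rewrite -rcons_cons rcons_uniq inE negb_or w_x w_p.
- by move=> z z_c; rewrite -rcons_cons mem_rcons in_cons z_c orbT.
- by rewrite /= !rcons_path e'p last_rcons /e' evw e_sym exw.
rewrite /= -!cats1 !gaps_cat !gaps_cons cats1 last_rcons evw e_sym exw /gaps /=.
by rewrite !addn0.
Qed.

Lemma cycle_through : exists c, [/\ uniq c, cycle e c & {subset B <= c}].
Proof.
have [m] : exists m, exists c,
    [/\ uniq c, {subset B <= c}, cycle e' c & cyclic_gaps e c <= m].
  exists (cyclic_gaps e (enum B)), (enum B); split=> //.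
  - exact: enum_uniq.
  - by move=> z; rewrite mem_enum.
  apply: cycle_from_next (enum_uniq _) _ => z z_B.
  by rewrite /e' -!(mem_enum B) mem_next z_B orbT.
elim: m => [|m IHm] [c [Uc Bc e'c le_m]].
  by exists c; split=> //; apply: no_gap_cycle; lia.
case: (boolP (cycle e c)) => [ec|/rotate_gap[i [x [p [def_c not_e gapE]]]]].
  by exists c.
move: Uc e'c; rewrite -(rot_uniq i) -(rot_cycle i) def_c => Uc /=.
rewrite rcons_path => /andP[e'p].
rewrite /e' (negbTE not_e) => /andP[Bv Bx].
have [c' [Uc' sub_c' e'c' le_c']] := close_gap Uc e'p Bx Bv.
apply: IHm; exists c'; split=> //; last first.
  by apply: leq_trans le_c' _; rewrite -ltnS -gapE.
by move=> z /Bc; rewrite -(mem_rot i) def_c => /sub_c'.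
Qed.

End Closing.

(** * From a dominating cycle to a Hamilton cycle of the line graph

    Edges are the elements of a finite type [W], and [ends] gives the set of ends
    of an edge, so that the edges of a graph and the vertices of its line graph
    left after a deletion are the same objects. *)

Section DominatingCycle.

Variables (T W : finType) (ends : W -> {set T}).

Definition joined : rel T := fun x y => [exists w, ends w == [set x; y]].

Definition touching : rel W := fun a b => ends a :&: ends b != set0.

Definition edges_hamiltonian : Prop :=
  exists s : seq W, [/\ uniq s, cycle touching s, 2 < size s & forall w, w \in s].

Lemma joinedP x y : reflect (exists w, ends w = [set x; y]) (joined x y).
Proof. by apply: (iffP existsP) => -[w /eqP]; exists w. Qed.

Lemma joined_sym : symmetric joined.
Proof. by move=> x y; apply/joinedP/joinedP=> -[w def_w]; exists w; rewrite setUC. Qed.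

Lemma touching_at v a b : v \in ends a -> v \in ends b -> touching a b.
Proof. by move=> va vb; apply/set0Pn; exists v; rewrite inE va vb. Qed.

Lemma next_neq (S : eqType) (c : seq S) v :
  uniq c -> 1 < size c -> v \in c -> next c v != v.
Proof.
move=> Uc c_gt1 c_v; have [i p def_c] := rot_to c_v.
move: c_gt1 (Uc); rewrite -(next_rot i Uc) -(size_rot i) -(rot_uniq i) def_c.
case: p {def_c} => [|a p] //= _; rewrite eqxx inE negb_or eq_sym.
by case/andP=> /andP[].
Qed.

Lemma next_next_neq (c : seq T) v :
  uniq c -> 2 < size c -> v \in c -> next c (next c v) != v.
Proof.
move=> Uc c_gt2 c_v; have [i p def_c] := rot_to c_v.
move: c_gt2 (Uc); rewrite -!(next_rot i Uc) -(size_rot i) -(rot_uniq i) def_c.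
case: p {def_c} => [|a [|b p]] //= _; rewrite eqxx !inE !negb_or.
case/and3P=> /and3P[v_a v_b _] _ _.
by rewrite (eq_sym a) (negbTE v_a) !eqxx eq_sym.
Qed.

Lemma flatten_blocks_uniq (c : seq T) (block : T -> seq W) (own : W -> T) :
    uniq c -> (forall v, v \in c -> uniq (block v)) ->
    (forall v w, v \in c -> w \in block v -> own w = v) ->
  uniq (flatten (map block c)).
Proof.
elim: c => //= v c IHc /andP[v_c Uc] Ub own_b; rewrite cat_uniq.
rewrite Ub ?mem_head //= andbC IHc //=; last 2 first.
- by move=> u c_u; apply: Ub; rewrite inE c_u orbT.
- by move=> u w c_u; apply: own_b; rewrite inE c_u orbT.
apply/hasPn=> w /flatten_mapP[u c_u w_u]; apply: contraNN v_c => w_v.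
by rewrite -(own_b v w) ?mem_head // (own_b u w) // inE c_u orbT.
Qed.

(** Each vertex [v] of an [f]-path contributes a block of edges at [v]. The last
    edge of the block, [exit v], also contains [f v], so it touches the first
    edge of the next block. *)
Lemma path_blocks (f : T -> T) (pre : T -> seq W) (exit : T -> W) a x p :
    {in x :: p, forall v, all (fun w => v \in ends w) (rcons (pre v) (exit v))} ->
    {in x :: p, forall v, f v \in ends (exit v)} ->
    x \in ends a -> fpath f x p ->
  let s := flatten [seq rcons (pre v) (exit v) | v <- x :: p] in
  path touching a s /\ last a s = exit (last x p).
Proof.
have path_star v b r :
    v \in ends b -> all (fun w => v \in ends w) r -> path touching b r.
  elim: r b => //= w r IHr b vb /andP[vw v_r].
  by rewrite (touching_at vb vw) IHr.
elim: p x a => [|y p IHp] x a at_v exit_v xa /= => [_|/andP[/eqP fx fp]].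
  by rewrite cats0 last_rcons; split=> //; apply: path_star xa (at_v x _); rewrite inE.
have := IHp y (exit x) _ _ _ fp; rewrite /= => -[].
- by move=> v p_v; apply: at_v; rewrite inE p_v orbT.
- by move=> v p_v; apply: exit_v; rewrite inE p_v orbT.
- by rewrite -fx exit_v ?mem_head.
move=> ps ls; rewrite cat_path last_cat last_rcons ls ps andbT; split=> //.
by apply: path_star xa (at_v x _); rewrite mem_head.
Qed.

(** Every edge is assigned to a vertex of the cycle that it contains, an edge of
    the cycle being assigned to the first of its two ends in the direction of the
    cycle. The bound on the size makes that end unique: on a cycle of length two
    both vertices would claim the same edge. *)
Lemma dominating_cycle_spans (c : seq T) :
    uniq c -> cycle joined c -> 2 < size c ->
    (forall w, exists2 v, v \in c & v \in ends w) ->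
  edges_hamiltonian.
Proof.
move=> Uc jc c_gt2 dom_c.
have edge_next v : v \in c -> exists w, ends w = [set v; next c v].
  by move=> c_v; apply/joinedP/(next_cycle jc).
have [w0 _] : exists w0 : W, true.
  by case: (c) c_gt2 edge_next => // x p _ /(_ x (mem_head x p))[w _]; exists w.
have /fin_all_exists[exit exitE] : forall v, exists w,
    v \in c -> ends w = [set v; next c v].
  move=> v; case: (boolP (v \in c)) => [/edge_next[w def_w]|_]; last by exists w0.
  by exists w.
have exit_inj : {in c &, injective exit}.
  move=> u v c_u c_v /(congr1 ends); rewrite !exitE // => eq_uv.
  apply/eqP/idPn=> u_v.
  have /set2P[/eqP|u_nv] : u \in [set v; next c v] by rewrite -eq_uv set21.
    by rewrite (negbTE u_v).
  have /set2P[/eqP|v_nu] : v \in [set u; next c u] by rewrite eq_uv set21.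
    by rewrite eq_sym (negbTE u_v).
  by have := next_next_neq Uc c_gt2 c_v; rewrite -u_nv -v_nu eqxx.
have /fin_all_exists[own ownP] : forall w, exists v,
    [/\ v \in c, v \in ends w & forall u, u \in c -> w = exit u -> v = u].
  move=> w; case: (boolP (has (fun u => w == exit u) c)) => [/hasP[v c_v /eqP ->]|/hasPn].
    exists v; split=> //; first by rewrite exitE ?set21.
    by move=> u c_u /exit_inj ->.
  move=> not_exit; have [v c_v v_w] := dom_c w; exists v; split=> // u c_u w_u.
  by have := not_exit u c_u; rewrite w_u eqxx.
pose pre v := [seq w <- enum W | (own w == v) && (w != exit v)].
pose block v := rcons (pre v) (exit v).
have own_exit v : v \in c -> own (exit v) = v.
  by move=> c_v; have [_ _ /(_ v c_v)->] := ownP (exit v).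
have own_block v w : v \in c -> w \in block v -> own w = v.
  move=> c_v; rewrite mem_rcons inE mem_filter => /orP[/eqP->|]; first exact: own_exit.
  by case/andP=> /andP[/eqP].
have s_w w : w \in flatten (map block c).
  have [c_v _ _] := ownP w; apply/flatten_mapP; exists (own w) => //.
  rewrite mem_rcons inE mem_filter eqxx mem_enum andbT.
  by case: (w == _).
have Us : uniq (flatten (map block c)).
  apply: flatten_blocks_uniq own_block => // v _.
  by rewrite rcons_uniq mem_filter eqxx andbF filter_uniq ?enum_uniq.
exists (flatten (map block c)); split=> //.
- rewrite (cycle_path w0).
  have [x [p def_c]] : exists x p, c = x :: p by case: (c) c_gt2 => // x p; exists x, p.
  have /andP[np /eqP nx] : fpath (next c) x p && (next c (last x p) == x).
    by have := cycle_next Uc; rewrite {2}def_c /= rcons_path.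
  have c_last : last x p \in c by rewrite def_c mem_last.
  have [] := @path_blocks (next c) pre exit (exit (last x p)) x p.
  + rewrite -def_c => v c_v; apply/allP=> w /(own_block v w c_v) <-.
    by have [] := ownP w.
  + by rewrite -def_c => v c_v; rewrite exitE ?set22.
  + by rewrite exitE // nx set22.
  + exact: np.
  rewrite -/block def_c; case: (flatten _) => //= a r.
  by move=> /andP[ta tr] lr; rewrite lr ta tr.
apply: leq_trans c_gt2 _; rewrite -(size_map exit c); apply: uniq_leq_size.
  by rewrite map_inj_in_uniq.
by move=> w _; apply: s_w.
Qed.

Hypothesis ends2 : forall w, #|ends w| = 2.

Lemma joined_neq x y : joined x y -> x != y.
Proof. by case/joinedP=> w def_w; have := ends2 w; rewrite def_w cards2; case: eqP. Qed.

Lemma joined_irr : irreflexive joined.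
Proof. by move=> x; apply/negbTE/negP=> /joined_neq; rewrite eqxx. Qed.

Lemma ends_joined w : exists x y, ends w = [set x; y] /\ joined x y.
Proof.
have /eqP/cards2P[x [y [_ def_w]]] := ends2 w.
by exists x, y; split=> //; apply/joinedP; exists w.
Qed.

Lemma degree_leq_edges u : #|nbrs joined u| <= #|W|.
Proof.
rewrite -(card_in_imset (f := fun z => [set u; z])) => [|y z].
  apply: leq_trans (leq_imset_card ends W); apply/subset_leq_card/subsetP=> A.
  by case/imsetP=> z; rewrite inE => /joinedP[w def_w] ->; rewrite -def_w imset_f.
rewrite !inE => /joined_neq u_y _ eq_yz.
have : y \in [set u; z] by rewrite -eq_yz set22.
by case/set2P=> // y_u; rewrite y_u eqxx in u_y.
Qed.

(** Edges that all share the end [v] may be visited in any order. There are at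
    least three of them: a neighbour of [v] has degree one, so the degree
    condition makes the degree of [v] at least three. *)
Lemma star_spans (w0 : W) v :
    4 <= #|T| ->
    (forall x y, joined x y -> #|T| <= #|nbrs joined x| + #|nbrs joined y|) ->
    (forall w, v \in ends w) ->
  edges_hamiltonian.
Proof.
move=> T_ge4 deg_sum v_all; exists (enum W); split=> [|||w]; last by rewrite mem_enum.
- exact: enum_uniq.
- by apply: cycle_from_next (enum_uniq _) _ => w _; apply: touching_at (v_all _) (v_all _).
rewrite -cardE; have leaf x : x != v -> nbrs joined x \subset [set v].
  move=> x_v; apply/subsetP=> y; rewrite !inE => /joinedP[w def_w].
  by have := v_all w; rewrite def_w !inE eq_sym (negbTE x_v) /= eq_sym.
have [y jvy] : exists y, joined v y.
  have [x [y [def_w jxy]]] := ends_joined w0.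
  have := v_all w0; rewrite def_w => /set2P[] ->; first by exists y.
  by exists x; rewrite joined_sym.
have y_v : y != v by rewrite eq_sym joined_neq.
apply: leq_trans (degree_leq_edges v).
by have := deg_sum _ _ jvy; have := subset_leq_card (leaf y y_v); rewrite cards1; lia.
Qed.

(** The theorem of Brualdi and Shanny on hamiltonian line graphs. *)
Theorem degree_sum_edges_hamiltonian (w0 : W) :
    4 <= #|T| ->
    (forall x y, joined x y -> #|T| <= #|nbrs joined x| + #|nbrs joined y|) ->
  edges_hamiltonian.
Proof.
move=> T_ge4 deg_sum.
pose B : {set T} := [set v | #|T| <= #|nbrs joined v|.*2].
have dom_B w : exists2 v, v \in B & v \in ends w.
  have [x [y [def_w /deg_sum]]] := ends_joined w.
  case: (boolP (x \in B)) => [Bx _|]; first by exists x; rewrite ?def_w ?set21.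
  by rewrite inE -ltnNge => ltx le; exists y; rewrite ?def_w ?set22 // inE; lia.
have [c [Uc jc Bc]] : exists c, [/\ uniq c, cycle joined c & {subset B <= c}].
  apply: cycle_through joined_sym joined_irr _ => x y; rewrite !inE; lia.
have dom_c w : exists2 v, v \in c & v \in ends w.
  by have [v /Bc] := dom_B w; exists v.
have [/(dominating_cycle_spans Uc jc)|] := ltnP 2 (size c); first by apply.
case: c Uc jc dom_c {Bc} => [|u [|v []]] //= Uc jc dom_c _.
- by have [] := dom_c w0.
- by rewrite joined_irr in jc.
have {jc} juv : joined u v by case/and3P: jc.
have {}dom_uv w : (u \in ends w) || (v \in ends w).
  by have [z] := dom_c w; rewrite !inE => /orP[] /eqP-> ->; rewrite ?orbT.
case: (set_0Vmem (nbrs joined u :&: nbrs joined v)) => [no_common|[a]].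
  (* If u has a neighbour a other than v then a is a leaf, since an edge from a
     to v would make a a common neighbour. So u is adjacent to every other
     vertex, and an edge from v elsewhere would give a common neighbour. *)
  have star_at_u a : joined u a -> a != v -> forall w, u \in ends w.
    move=> jua a_v w; have sub_u : nbrs joined a \subset [set u].
      apply/subsetP=> z; rewrite !inE => /[dup] /joinedP[w' def_w'] jaz.
      have := dom_uv w'; rewrite def_w' !inE => /orP[] /orP[] /eqP eq_z.
      - by rewrite eq_z joined_irr in jua.
      - by rewrite eq_z.
      - by rewrite eq_z eqxx in a_v.
      have : a \in nbrs joined u :&: nbrs joined v.
        by rewrite !inE jua eq_z joined_sym.
      by rewrite no_common inE.
    have nbrs_u : nbrs joined u = ~: [set u].
      apply/eqP; rewrite eqEcard cardsC1; apply/andP; split.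
        by apply/subsetP=> z; rewrite !inE eq_sym => /joined_neq.
      by have := deg_sum _ _ jua; have := subset_leq_card sub_u; rewrite cards1; lia.
    have [x [y [def_w jxy]]] := ends_joined w.
    apply: contraT; rewrite def_w !inE negb_or => /andP[u_x u_y].
    have /orP[] := dom_uv w; rewrite def_w !inE.
      by rewrite (negbTE u_x) (negbTE u_y).
    have in_u z : u != z -> z \in nbrs joined u.
      by rewrite nbrs_u !inE eq_sym.
    case/orP=> /eqP eq_v.
      have : y \in nbrs joined u :&: nbrs joined v.
        by rewrite inE in_u // inE eq_v jxy.
      by rewrite no_common inE.
    have : x \in nbrs joined u :&: nbrs joined v.
      by rewrite inE in_u // inE eq_v joined_sym jxy.
    by rewrite no_common inE.
  case: (pickP [pred a | joined u a && (a != v)]) => [a /andP[jua a_v]|only_v].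
    exact: star_spans (star_at_u a jua a_v).
  apply: (@star_spans w0 v) => // w; have [x [y [def_w jxy]]] := ends_joined w.
  have nbr_u z : joined u z -> z = v.
    by move=> juz; have /= := only_v z; rewrite juz => /negbFE/eqP.
  have := dom_uv w; rewrite def_w !inE orbC => /orP[] // /orP[] /eqP eq_u.
    by move: jxy; rewrite -eq_u => /nbr_u ->; rewrite eqxx orbT.
  by move: jxy; rewrite joined_sym -eq_u => /nbr_u ->; rewrite eqxx.
rewrite !inE => /andP[jua jva].
apply: (@dominating_cycle_spans [:: u; v; a]) => //=.
- by rewrite !inE negb_or (joined_neq juv) (joined_neq jua) (joined_neq jva).
- by rewrite juv jva joined_sym jua.
by move=> w; have /orP[] := dom_uv w; [exists u | exists v]; rewrite ?inE ?eqxx ?orbT.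
Qed.

End DominatingCycle.

(** * Deleting edges *)

(** The pairs in [Y] at [x] or at [y] are counted injectively by their other
    end, and only the pair [set x; y] could be counted at both. *)
Lemma card_removed_nbrs (T : finType) (Y : {set {set T}}) (x y : T) :
  x != y ->
  #|[set z | [set x; z] \in Y] :\ y| + #|[set z | [set y; z] \in Y]| <= #|Y|.
Proof.
move=> x_y; have pair_inj u : injective (fun z : T => [set u; z]).
  move=> z z' eq_zz'; have : z \in [set u; z'] by rewrite -eq_zz' set22.
  case/set2P=> // z_u; have : z' \in [set u; z] by rewrite eq_zz' set22.
  by case/set2P=> // ->.
rewrite -(card_imset _ (pair_inj x)) -(card_imset _ (pair_inj y)) -cardsUI.
set I := _ :&: _; have -> : I = set0.
  apply/setP=> A; rewrite !inE; apply/negP=> /andP[].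
  case/imsetP=> z; rewrite !inE => /andP[z_y _] -> /imsetP[z' _ eq_zz'].
  have : y \in [set x; z] by rewrite eq_zz' set21.
  by rewrite !inE eq_sym (negbTE x_y) eq_sym (negbTE z_y).
rewrite cards0 addn0; apply/subset_leq_card; rewrite subUset.
apply/andP; split; apply/subsetP=> A /imsetP[z]; rewrite !inE.
  by case/andP=> _ xz ->.
by move=> yz ->.
Qed.

Section EdgeDeletion.

Variables (G : sgraph) (X : {set line_graph G}).

Definition kept_ends (w : del_vertices X) : {set G} := val (val w).

Let Y : {set {set G}} := [set val A | A : line_graph G in X].

Lemma edge_setP (A : {set G}) :
  reflect (exists x y : G, adj x y /\ A = [set x; y]) (A \in edge_set G).
Proof.
rewrite inE; apply: (iffP existsP) => [[x /existsP[y /andP[xy /eqP ->]]]|].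
  by exists x, y.
by case=> x [y [xy ->]]; exists x; apply/existsP; exists y; rewrite xy eqxx.
Qed.

Lemma card_kept_ends w : #|kept_ends w| = 2.
Proof.
have /edge_setP[x [y [xy def_w]]] : kept_ends w \in edge_set G := valP (val w).
by rewrite def_w cards2; case: eqP xy => // ->; rewrite adj_irr.
Qed.

Lemma adj_edge (x y : G) : adj x y -> [set x; y] \in edge_set G.
Proof. by move=> xy; apply/edge_setP; exists x, y. Qed.

Lemma joined_adj (x y : G) : joined kept_ends x y -> adj x y /\ [set x; y] \notin Y.
Proof.
move=> /[dup] /(joined_neq card_kept_ends) x_y /joinedP[w def_w]; split.
  have /edge_setP[a [b [ab]]] : kept_ends w \in edge_set G := valP (val w).
  rewrite def_w => eq_ab.
  have /set2P x_ab : x \in [set a; b] by rewrite -eq_ab set21.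
  have /set2P y_ab : y \in [set a; b] by rewrite -eq_ab set22.
  by move: x_y; case: x_ab y_ab => -> [] ->; rewrite ?eqxx // adj_sym.
apply/imsetP=> -[A A_X]; rewrite -def_w => /val_inj eq_A.
by have := valP w; rewrite eq_A A_X.
Qed.

Lemma adj_joined (x y : G) : adj x y -> [set x; y] \notin Y -> joined kept_ends x y.
Proof.
move=> xy notY; pose A : line_graph G := Sub [set x; y] (adj_edge xy).
have notX : A \notin X.
  by apply: contraNN notY => X_A; apply/imsetP; exists A.
by apply/joinedP; exists (Sub A notX : del_vertices X).
Qed.

Lemma deg_kept (x : G) :
  deg x <= #|nbrs (joined kept_ends) x| + #|[set z | [set x; z] \in Y]|.
Proof.
apply: leq_trans (leq_card_setU _ _); apply/subset_leq_card/subsetP=> z.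
rewrite !inE => xz; case: (boolP (_ \in Y)) => [|notY]; first by rewrite orbT.
by rewrite adj_joined.
Qed.

(** The correction term vanishes for the edges that remain. Allowing for a
    deleted edge [set x; y] shows that some edge remains: its two ends together
    keep at least [#|G| - 1] neighbours. *)
Lemma kept_degree_sum k (x y : G) :
    #|X| <= k -> adj x y -> #|G| + k <= deg x + deg y ->
  #|G| <= #|nbrs (joined kept_ends) x| + #|nbrs (joined kept_ends) y|
          + ([set x; y] \in Y).
Proof.
move=> X_k xy; have x_y : x != y by apply: contraTneq xy => ->; rewrite adj_irr.
have := card_removed_nbrs Y x_y; have := deg_kept x; have := deg_kept y.
have : #|Y| <= #|X| by apply: leq_imset_card.
rewrite (cardsD1 y [set z | [set x; z] \in Y]) inE; lia.
Qed.

End EdgeDeletion.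

Theorem corollary8 (G : sgraph) (n k : nat)
    (card_G : #|G| = n) (n_ge4 : 4 <= n) (k_ge1 : 1 <= k)
    (conn_G : connected G)
    (deg_sum : forall x y : G, adj x y -> n + k <= deg x + deg y) :
  k_hamiltonian k (line_graph G).
Proof.
move=> X X_k; rewrite -card_G in n_ge4 deg_sum.
have sum_kept x y : joined (@kept_ends G X) x y ->
    #|G| <= #|nbrs (joined (@kept_ends G X)) x|
            + #|nbrs (joined (@kept_ends G X)) y|.
  case/joined_adj=> xy notY; have := kept_degree_sum X_k xy (deg_sum _ _ xy).
  by rewrite (negbTE notY) addn0.
have [x [y xy]] : exists x y : G, adj x y.
  have /card_gt1P[x [y [_ _ x_y]]] : 1 < #|G| by apply: leq_trans n_ge4.
  have /connectP[[|z p] /=] := conn_G x y.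
    by move=> _ eq_xy; rewrite eq_xy eqxx in x_y.
  by case/andP=> xz _ _; exists x, z.
have [w0] : exists w0 : del_vertices X, true.
  have := kept_degree_sum X_k xy (deg_sum _ _ xy).
  case: (set_0Vmem (nbrs (joined (@kept_ends G X)) x)) => [->|[z]]; last first.
    by rewrite inE => /joinedP[w _] _; exists w.
  case: (set_0Vmem (nbrs (joined (@kept_ends G X)) y)) => [->|[z]]; last first.
    by rewrite inE => /joinedP[w _] _; exists w.
  by rewrite cards0; case: (_ \in _); lia.
move=> _; have [s [Us ts s_gt2 s_all]] :=
  degree_sum_edges_hamiltonian (@card_kept_ends G X) w0 n_ge4 sum_kept.
exists s; split=> //; apply/andP; split=> //; apply: cycle_from_next => // w s_w.
rewrite /= /del_adj /= /line_adj /= (inj_eq val_inj); apply/andP; split.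
  by rewrite eq_sym next_neq // ltnW.
exact: next_cycle ts s_w.
Qed.
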